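(* Let $(A,v)$ be a very true bounded pseudo-BCK algebra. Define $\varsigma_v^1,\varsigma_v^2:A\to A$ by $\varsigma_v^1(x)=v(x^{-})^{\sim}$ and $\varsigma_v^2(x)=v(x^{\sim})^{-}$ for all $x\in A$. Then $(A,\rightarrow,\rightsquigarrow,v,\varsigma_v^1,\varsigma_v^2,0,1)$ is a pseudo-BCK$_{vt,st}$ algebra.
   Context: A pseudo-BCK algebra is a structure $(A,\leq,\rightarrow,\rightsquigarrow,1)$ where $\leq$ is a binary relation on $A$, $\rightarrow$ and $\rightsquigarrow$ are binary operations on $A$ and $1\in A$, such that for all $x,y,z\in A$: $x\rightarrow y\leq (y\rightarrow z)\rightsquigarrow (x\rightarrow z)$ and $x\rightsquigarrow y\leq (y\rightsquigarrow z)\rightarrow (x\rightsquigarrow z)$; $x\leq (x\rightarrow y)\rightsquigarrow y$ and $x\leq (x\rightsquigarrow y)\rightarrow y$; $x\leq x$; $x\leq 1$; if $x\leq y$ and $y\leq x$ then $x=y$; $x\leq y$ iff $x\rightarrow y=1$ iff $x\rightsquigarrow y=1$. It is bounded if there is an element $0\in A$ with $0\leq x$ for all $x\in A$; it is then written $(A,\rightarrow,\rightsquigarrow,0,1)$, and one sets $x^{-}:=x\rightarrow 0$ and $x^{\sim}:=x\rightsquigarrow 0$. A very true operator on a pseudo-BCK algebra $A$ is a map $v:A\to A$ such that for all $x,y\in A$: $v(1)=1$; $v(x)\leq x$; $v(x)\leq v(v(x))$; $v(x\rightarrow y)\leq v(x)\rightarrow v(y)$ and $v(x\rightsquigarrow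 y)\leq v(x)\rightsquigarrow v(y)$. The pair $(A,v)$ is then called a very true pseudo-BCK algebra (very true bounded pseudo-BCK algebra if $A$ is bounded). A pseudo-BCK$_{vt,st}$ algebra $(A,\rightarrow,\rightsquigarrow,v,s_1,s_2,0,1)$ is a very true bounded pseudo-BCK algebra $(A,v)$ endowed with two unary operators $s_1,s_2:A\to A$ such that for all $x,y\in A$: $s_1(0)=s_2(0)=0$; $x\leq s_1(x)$ and $x\leq s_2(x)$; $v(x\rightarrow y)\leq s_1(x)\rightarrow s_1(y)$ and $v(x\rightsquigarrow y)\leq s_2(x)\rightsquigarrow s_2(y)$. *)

(* Defs.v *)
Declare Scope pbck_scope.
Delimit Scope pbck_scope with pbck.

Reserved Notation "x --> y" (at level 55, right associativity).
Reserved Notation "x ~~> y" (at level 55, right associativity).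

Record pseudoBCK : Type := PseudoBCK {
  carrier :> Type;
  le : carrier -> carrier -> Prop where "x <= y" := (le x y);
  imp : carrier -> carrier -> carrier where "x --> y" := (imp x y);
  simp : carrier -> carrier -> carrier where "x ~~> y" := (simp x y);
  one : carrier;
  imp_trans : forall x y z, x --> y <= (y --> z) ~~> (x --> z);
  simp_trans : forall x y z, x ~~> y <= (y ~~> z) --> (x ~~> z);
  le_imp_simp : forall x y, x <= (x --> y) ~~> y;
  le_simp_imp : forall x y, x <= (x ~~> y) --> y;
  le_refl : forall x, x <= x;
  le_one : forall x, x <= one;
  le_antisym : forall x y, x <= y -> y <= x -> x = y;
  le_imp_one : forall x y, x <= y <-> x --> y = one;
  le_simp_one : forall x y, x <= y <-> x ~~> y = one
}.

Arguments le {_} _ _.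
Arguments imp {_} _ _.
Arguments simp {_} _ _.
Arguments one {_}.

Notation "x <= y" := (le x y) : pbck_scope.
Notation "x --> y" := (imp x y) : pbck_scope.
Notation "x ~~> y" := (simp x y) : pbck_scope.
Open Scope pbck_scope.

Record boundedPseudoBCK : Type := BoundedPseudoBCK {
  pbck :> pseudoBCK;
  zero : pbck;
  zero_le : forall x : pbck, zero <= x
}.

Arguments zero {_}.

Definition neg_minus {A : boundedPseudoBCK} (x : A) : A := x --> zero.
Definition neg_tilde {A : boundedPseudoBCK} (x : A) : A := x ~~> zero.

Record very_true {A : pseudoBCK} (v : A -> A) : Prop := VeryTrue {
  vt_one : v one = one;
  vt_le : forall x, v x <= x;
  vt_idem : forall x, v x <= v (v x);
  vt_imp : forall x y, v (x --> y) <= v x --> v y;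
  vt_simp : forall x y, v (x ~~> y) <= v x ~~> v y
}.

Record pseudoBCK_vt_st (A : boundedPseudoBCK) (v s1 s2 : A -> A) : Prop :=
  PseudoBCK_vt_st {
  vtst_very_true : very_true v;
  st1_zero : s1 zero = zero;
  st2_zero : s2 zero = zero;
  st1_ge : forall x, x <= s1 x;
  st2_ge : forall x, x <= s2 x;
  st1_imp : forall x y, v (x --> y) <= s1 x --> s1 y;
  st2_simp : forall x y, v (x ~~> y) <= s2 x ~~> s2 y
}.

Definition varsigma1 {A : boundedPseudoBCK} (v : A -> A) (x : A) : A :=
  neg_tilde (v (neg_minus x)).
Definition varsigma2 {A : boundedPseudoBCK} (v : A -> A) (x : A) : A :=
  neg_minus (v (neg_tilde x)).

(* Main.v *)
Require Import Defs.

(** Both operators are double negations with [v] inserted in the middle, and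
    each required inequality is the corresponding one for double negation,
    weakened or transported by [v].

    - [x <= varsigma1 v x]: the element [x] lies below its double negation
      [(x --> zero) ~~> zero], and replacing [x --> zero] by the smaller
      [v (x --> zero)] enlarges the outer, antitone negation
      ([le_varsigma1]).
    - [v (x --> y) <= varsigma1 v x --> varsigma1 v y]: contraposition
      [x --> y <= (y --> zero) ~~> (x --> zero)] is moved through [v], which is
      monotone and distributes over [~~>]; a second contraposition, now for
      [~~>], restores the original direction ([vt_imp_varsigma1]).

    The axioms are invariant under exchanging the two implications, and this
    exchange turns [varsigma1] into [varsigma2]; the statements about
    [varsigma2] are those about [varsigma1] read in the opposite algebra. *)

Lemma eq_one (A : pseudoBCK) (x : A) : one <= x -> x = one.
Proof. intros H; apply le_antisym; [apply le_one | exact H]. Qed.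

Lemma le_of_one_le_imp (A : pseudoBCK) (x y : A) : one <= x --> y -> x <= y.
Proof. intros H; apply le_imp_one, eq_one, H. Qed.

Lemma simp_one_le (A : pseudoBCK) (x : A) : one ~~> x <= x.
Proof. apply le_of_one_le_imp, le_simp_imp. Qed.

(** Transitivity of the order is not among the axioms: it is the instance of
    [imp_trans] in which both implications involved equal [one]. *)
Lemma le_trans (A : pseudoBCK) (x y z : A) : x <= y -> y <= z -> x <= z.
Proof.
  intros Hxy Hyz.
  apply le_of_one_le_imp, le_simp_one, eq_one.
  pose proof (imp_trans A x y z) as H.
  rewrite (proj1 (le_imp_one A x y) Hxy) in H.
  rewrite (proj1 (le_imp_one A y z) Hyz) in H.
  exact H.
Qed.

Lemma simp_anti_l (A : pseudoBCK) (x y z : A) :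
  x <= y -> y ~~> z <= x ~~> z.
Proof.
  intros Hxy.
  apply le_of_one_le_imp.
  rewrite <- (proj1 (le_simp_one A x y) Hxy).
  apply simp_trans.
Qed.

(** Distributivity over [-->] already forces monotonicity, since [x <= y]
    means [x --> y = one] and [v] fixes [one]. *)
Lemma vt_mono (A : pseudoBCK) (v : A -> A) (hv : very_true v) (x y : A) :
  x <= y -> v x <= v y.
Proof.
  intros Hxy.
  apply le_of_one_le_imp.
  pose proof (vt_imp v hv x y) as H.
  rewrite (proj1 (le_imp_one A x y) Hxy), (vt_one v hv) in H.
  exact H.
Qed.

Section Varsigma1.

Variables (A : boundedPseudoBCK) (v : A -> A).
Hypothesis hv : very_true v.

Lemma varsigma1_zero : varsigma1 v zero = zero.
Proof.
  unfold varsigma1, neg_minus, neg_tilde.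
  rewrite (proj1 (le_imp_one A zero zero) (le_refl A zero)), (vt_one v hv).
  apply le_antisym; [apply simp_one_le | apply zero_le].
Qed.

Lemma le_varsigma1 (x : A) : x <= varsigma1 v x.
Proof.
  apply le_trans with ((x --> zero) ~~> zero).
  - apply le_imp_simp.
  - apply simp_anti_l, (vt_le v hv).
Qed.

Lemma vt_imp_varsigma1 (x y : A) :
  v (x --> y) <= varsigma1 v x --> varsigma1 v y.
Proof.
  apply le_trans with (v ((y --> zero) ~~> (x --> zero))).
  - apply vt_mono, imp_trans; exact hv.
  - apply le_trans with (v (y --> zero) ~~> v (x --> zero)).
    + apply (vt_simp v hv).
    + apply simp_trans.
Qed.

End Varsigma1.

Definition opposite (A : pseudoBCK) : pseudoBCK :=
  PseudoBCK A le simp imp one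
    (simp_trans A) (imp_trans A) (le_simp_imp A) (le_imp_simp A)
    (le_refl A) (le_one A) (le_antisym A) (le_simp_one A) (le_imp_one A).

Definition bounded_opposite (A : boundedPseudoBCK) : boundedPseudoBCK :=
  BoundedPseudoBCK (opposite A) (@zero A) (zero_le A).

Lemma very_true_opposite (A : pseudoBCK) (v : A -> A) :
  very_true v -> @very_true (opposite A) v.
Proof. intros [H1 Hle Hidem Himp Hsimp]; constructor; assumption. Qed.

Theorem theorem4p17 (A : boundedPseudoBCK) (v : A -> A) (hv : very_true v) :
  pseudoBCK_vt_st A v (varsigma1 v) (varsigma2 v).
Proof.
  pose proof (very_true_opposite A v hv) as hv'.
  (* Up to conversion, [varsigma2 v] is [varsigma1 v] over
     [bounded_opposite A]. *)
  constructor.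
  - exact hv.
  - exact (varsigma1_zero A v hv).
  - exact (varsigma1_zero (bounded_opposite A) v hv').
  - exact (le_varsigma1 A v hv).
  - exact (le_varsigma1 (bounded_opposite A) v hv').
  - exact (vt_imp_varsigma1 A v hv).
  - exact (vt_imp_varsigma1 (bounded_opposite A) v hv').
Qed.
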